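(* Let $A$ be an integral domain of Krull dimension one, let $a\in A$ be a nonzero nonunit, and let $x$ be an indeterminate over $A$. Then the extension $A[[x]]\hookrightarrow A_a[[x]]$ is a trivial generic fiber (TGF) extension; that is, every nonzero prime ideal of $A_a[[x]]$ has nonzero intersection with $A[[x]]$.
   Context: For a domain $A$ and $0\neq a\in A$, $A_a$ denotes the fraction ring $A[1/a]$. An extension $R\subseteq S$ of integral domains is called a trivial generic fiber (TGF) extension if every nonzero prime ideal of $S$ has nonzero intersection with $R$. *)

(* Defs.v *)
From HB Require Import structures.
From mathcomp Require Import all_boot all_order all_algebra.
From mathcomp Require Import boolp.

Set Implicit Arguments.
Unset Strict Implicit.
Unset Printing Implicit Defensive.

Import GRing.Theory.
Local Open Scope ring_scope.

Reserved Notation "{ 'powser' R }" (format "{ 'powser'  R }").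

(** Prime ideals are the [prime_idealr] of ring_quotient: proper ideals, given
    by boolean predicates, that are prime.  Under the classical axioms of boolp
    every subset of a ring is given by a boolean predicate. *)

Section KrullDimension.
Variable R : comNzRingType.

Definition prime_chain (n : nat) (c : 'I_n.+1 -> prime_idealr R) : Prop :=
  forall i j : 'I_n.+1, (i < j)%N ->
    {subset c i <= c j} /\ exists2 x, x \in c j & x \notin c i.

Definition has_krull_dim (d : nat) : Prop :=
  (exists c : 'I_d.+1 -> prime_idealr R, prime_chain c) /\
  (forall (n : nat) (c : 'I_n.+1 -> prime_idealr R), prime_chain c -> (n <= d)%N).

End KrullDimension.

Definition nonzero_ideal (R : nzRingType) (P : {pred R}) : Prop :=
  exists2 x, x \in P & x != 0.

Definition tgf_extension (R S : idomainType) (f : {rmorphism R -> S}) : Prop :=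
  injective f /\
  forall Q : prime_idealr S, nonzero_ideal Q -> exists2 r : R, f r \in Q & r != 0.

(** The unit-ring structure that classical logic puts on any commutative ring. *)
Section ClassicalUnits.
Variable R : comNzRingType.

Definition cunit : {pred R} := fun x => `[< exists y, y * x = 1 >].

Definition cinv (x : R) : R :=
  if pselect (exists y, y * x = 1) is left h then projT1 (cid h) else x.

Lemma cmulVr : {in cunit, left_inverse 1 cinv *%R}.
Proof.
move=> x /asboolP h; rewrite /cinv; case: pselect => // h'.
by case: cid.
Qed.

Lemma cunitPl (x y : R) : y * x = 1 -> cunit x.
Proof. by move=> h; apply/asboolP; exists y. Qed.

Lemma cinv_out : {in [predC cunit], cinv =1 id}.
Proof.
move=> x /negP h; rewrite /cinv; case: pselect => // h'.
by case: h; apply/asboolP.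
Qed.

End ClassicalUnits.

Record powser (R : Type) := Powser { coefps : nat -> R }.

Notation "{ 'powser' R }" := (powser R) : type_scope.

HB.instance Definition _ (R : Type) := [isNew for @coefps R].

HB.instance Definition _ (R : choiceType) := [Choice of {powser R} by <:].

Section PowerSeriesRing.
Variable R : comNzRingType.
Implicit Types f g h : {powser R}.

Lemma powserP f g : (forall n, coefps f n = coefps g n) -> f = g.
Proof. by move=> e; apply: val_inj; apply: funext. Qed.

Definition ps_zero : {powser R} := Powser (fun=> 0).
Definition ps_opp f := Powser (fun n => - coefps f n).
Definition ps_add f g := Powser (fun n => coefps f n + coefps g n).
Definition ps_one : {powser R} := Powser (fun n => (n == 0)%:R).
Definition ps_mul f g :=
  Powser (fun n => \sum_(i < n.+1) coefps f i * coefps g (n - i)).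

Fact ps_addA : associative ps_add.
Proof. by move=> f g h; apply: powserP => n; rewrite /= addrA. Qed.
Fact ps_addC : commutative ps_add.
Proof. by move=> f g; apply: powserP => n; rewrite /= addrC. Qed.
Fact ps_add0 : left_id ps_zero ps_add.
Proof. by move=> f; apply: powserP => n; rewrite /= add0r. Qed.
Fact ps_addN : left_inverse ps_zero ps_opp ps_add.
Proof. by move=> f; apply: powserP => n; rewrite /= addNr. Qed.

HB.instance Definition _ :=
  GRing.isZmodule.Build {powser R} ps_addA ps_addC ps_add0 ps_addN.

Let trunc N f : {poly R} := \poly_(i < N) coefps f i.

Let coef_trunc_mul N f g n :
  (n < N)%N -> coefps (ps_mul f g) n = (trunc N f * trunc N g)`_n.
Proof.
move=> nN; rewrite coefM /=; apply: eq_bigr => i _.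
rewrite !coef_poly (leq_ltn_trans (leq_subr _ _) nN).
by rewrite (leq_ltn_trans _ nN) // -ltnS.
Qed.

Fact ps_mulC : commutative ps_mul.
Proof.
by move=> f g; apply: powserP => n; rewrite !(coef_trunc_mul _ _ (ltnSn n)) mulrC.
Qed.
Fact ps_mulA : associative ps_mul.
Proof.
move=> f g h; apply: powserP => n.
have trE u v w : coefps (ps_mul u (ps_mul v w)) n =
    (trunc n.+1 u * (trunc n.+1 v * trunc n.+1 w))`_n.
  rewrite coefM; apply: eq_bigr => i _; rewrite coef_poly ltn_ord.
  by rewrite (@coef_trunc_mul n.+1) // ltnS leq_subr.
by rewrite (ps_mulC (ps_mul f g)) !trE mulrA [_ * trunc _ h]mulrC.
Qed.
Fact ps_mul1 : left_id ps_one ps_mul.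
Proof.
move=> f; apply: powserP => n; rewrite /= big_ord_recl /= mul1r subn0.
by rewrite big1 ?addr0 // => i _; rewrite mul0r.
Qed.
Fact ps_mulDl : left_distributive ps_mul ps_add.
Proof.
move=> f g h; apply: powserP => n; rewrite /= -big_split /=.
by apply: eq_bigr => i _; rewrite mulrDl.
Qed.
Fact ps_oner_neq0 : ps_one != 0.
Proof. by apply/eqP => /(congr1 (@coefps R ^~ 0%N)) /= /eqP; rewrite oner_eq0. Qed.

HB.instance Definition _ := GRing.Zmodule_isComNzRing.Build {powser R}
  ps_mulA ps_mulC ps_mul1 ps_mulDl ps_oner_neq0.

HB.instance Definition _ := GRing.ComNzRing_hasMulInverse.Build {powser R}
  (@cmulVr {powser R}) (@cunitPl {powser R}) (@cinv_out {powser R}).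

Lemma coefps0 n : coefps (0 : {powser R}) n = 0. Proof. by []. Qed.
Lemma coefps1 n : coefps (1 : {powser R}) n = (n == 0)%:R. Proof. by []. Qed.
Lemma coefpsN f n : coefps (- f) n = - coefps f n. Proof. by []. Qed.
Lemma coefpsD f g n : coefps (f + g) n = coefps f n + coefps g n.
Proof. by []. Qed.
Lemma coefpsM f g n :
  coefps (f * g) n = \sum_(i < n.+1) coefps f i * coefps g (n - i).
Proof. by []. Qed.

End PowerSeriesRing.

Section PowerSeriesDomain.
Variable R : idomainType.
Implicit Types f g : {powser R}.

Lemma powser_order f : f != 0 ->
  exists2 n, coefps f n != 0 & forall m, (m < n)%N -> coefps f m = 0.
Proof.
move=> f0; have ex : exists n, coefps f n != 0.
  apply: contrapT => h; case/eqP: f0; apply: powserP => n.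
  by apply/eqP/negPn/negP => hn; apply: h; exists n.
case: (ex_minnP ex) => n hn min; exists n => // m mn.
by apply/eqP/negPn/negP => /min; rewrite leqNgt mn.
Qed.

Fact powser_integral : GRing.integral_domain_axiom {powser R}.
Proof.
move=> f g fg0; apply/norP => -[/powser_order [m fm fm0] /powser_order [n gn gn0]].
have /eqP := congr1 (@coefps R ^~ (m + n)%N) fg0.
have mlt : (m < (m + n).+1)%N by rewrite ltnS leq_addr.
rewrite coefpsM coefps0 (bigD1 (Ordinal mlt)) //= addKn big1 ?addr0.
  by rewrite mulf_eq0 (negPf fm) (negPf gn).
move=> i; rewrite -val_eqE /= => im; case: (ltnP i m) => [/fm0 ->|mi].
  by rewrite mul0r.
have {}mi : (m < i)%N by rewrite ltn_neqAle eq_sym im.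
by rewrite gn0 ?mulr0 // ltn_subLR ?ltn_add2r // -ltnS.
Qed.

HB.instance Definition _ :=
  GRing.ComUnitRing_isIntegral.Build {powser R} powser_integral.

End PowerSeriesDomain.

Section MapPowser.
Variables (R S : comNzRingType) (phi : {rmorphism R -> S}).

Definition map_powser (f : {powser R}) : {powser S} :=
  Powser (fun n => phi (coefps f n)).

Fact map_powser_is_zmod_morphism : zmod_morphism map_powser.
Proof. by move=> f g; apply: powserP => n; rewrite /= rmorphB. Qed.
Fact map_powser_is_monoid_morphism : monoid_morphism map_powser.
Proof.
split=> [|f g]; apply: powserP => n; first by rewrite /= rmorph_nat.
by rewrite /= rmorph_sum; apply: eq_bigr => i _; rewrite rmorphM.
Qed.

HB.instance Definition _ := GRing.isZmodMorphism.Build {powser R} {powser S}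
  map_powser map_powser_is_zmod_morphism.
HB.instance Definition _ := GRing.isMonoidMorphism.Build {powser R} {powser S}
  map_powser map_powser_is_monoid_morphism.

End MapPowser.

(** [frac_at a] is A[1/a], as the subring of the fraction field of A whose
    elements are the b / a^n. *)
Section FracAt.
Variables (A : idomainType) (a : A).

Local Notation "x %:F" := (@FracField.tofrac A x).

Definition frac_at_pred : {pred {fraction A}} :=
  fun u => `[< exists (b : A) (n : nat), u = b%:F / a%:F ^+ n >].

Fact frac_at_pred_subring : subring_closed frac_at_pred.
Proof.
have in_A b : b%:F \in frac_at_pred.
  by apply/asboolP; exists b, 0%N; rewrite expr0 divr1.
have [a0|a_neq0] := eqVneq a 0.
  have inP u : u \in frac_at_pred -> exists b, u = b%:F.
    move=> /asboolP[b [n ->]]; exists (if n is 0%N then b else 0).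
    case: n => [|n]; first by rewrite expr0 divr1.
    by rewrite a0 tofrac0 expr0n /= invr0 mulr0.
  split=> [|u v /inP[b ->] /inP[c ->]|u v /inP[b ->] /inP[c ->]].
  - by rewrite -tofrac1.
  - by rewrite -tofracB.
  - by rewrite -tofracM.
have aF n : a%:F ^+ n != 0 by rewrite expf_neq0 // tofrac_eq0.
split=> [|u v /asboolP[b [n ->]] /asboolP[c [m ->]]
         |u v /asboolP[b [n ->]] /asboolP[c [m ->]]].
- by rewrite -tofrac1.
- apply/asboolP; exists (b * a ^+ m - c * a ^+ n), (n + m)%N.
  by rewrite -mulNr addf_div // tofracB !tofracM !tofracXn exprD mulNr.
- apply/asboolP; exists (b * c), (n + m)%N.
  by rewrite mulf_div tofracM exprD.
Qed.

HB.instance Definition _ :=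
  GRing.isSubringClosed.Build {fraction A} frac_at_pred frac_at_pred_subring.

Record frac_at := FracAt { frac_at_val : {fraction A};
                           frac_at_valP : frac_at_val \in frac_at_pred }.

HB.instance Definition _ := [isSub for frac_at_val].
HB.instance Definition _ := [Choice of frac_at by <:].
HB.instance Definition _ := [SubChoice_isSubComNzRing of frac_at by <:].

HB.instance Definition _ := GRing.ComNzRing_hasMulInverse.Build frac_at
  (@cmulVr frac_at) (@cunitPl frac_at) (@cinv_out frac_at).

HB.instance Definition _ := [SubComUnitRing_isSubIntegralDomain of frac_at by <:].

Fact to_frac_at_subproof (b : A) : b%:F \in frac_at_pred.
Proof. by apply/asboolP; exists b, 0%N; rewrite expr0 divr1. Qed.

Definition to_frac_at (b : A) : frac_at := FracAt (to_frac_at_subproof b).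

Fact to_frac_at_is_zmod_morphism : zmod_morphism to_frac_at.
Proof. by move=> b c; apply: val_inj; rewrite /= tofracB. Qed.
Fact to_frac_at_is_monoid_morphism : monoid_morphism to_frac_at.
Proof.
by split=> [|b c]; apply: val_inj; rewrite /= ?tofrac1 ?tofracM.
Qed.

HB.instance Definition _ := GRing.isZmodMorphism.Build A frac_at
  to_frac_at to_frac_at_is_zmod_morphism.
HB.instance Definition _ := GRing.isMonoidMorphism.Build A frac_at
  to_frac_at to_frac_at_is_monoid_morphism.

End FracAt.

(* Main.v *)
Require Import Defs.
From HB Require Import structures.
From mathcomp Require Import all_boot all_order all_algebra.
From mathcomp Require Import boolp classical_sets ring.

(** Write [A_a] for [frac_at a].  The map is injective because [A -> A_a] is.
    For the primes, a stronger fact holds: every nonzero power series [f] over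
    [A_a] has a multiple [f * g] that is nonzero with all coefficients in [A].

    Let [v] be the lowest nonzero coefficient of [f].  Solving for the
    coefficients of [g] one at a time, the next coefficient of [f * g] is
    [u + v * h], where [u] depends on the coefficients already chosen and [h] is
    the new one.  So [g] exists as soon as every [u] in [A_a] is congruent to an
    element of [A] modulo [v A_a] ([mul_in_map_powser]).  Clearing denominators,
    [v] may be replaced by an associate [b != 0] in [A], and the requirement is
    that [A / bA -> (A / bA)_a] be surjective.

    This is where the dimension enters.  Primes of [A] containing [b] are
    maximal, so [A / bA] is zero-dimensional, and there every element [a]
    satisfies [a ^ n = c * a ^ n.+1] for some [n] and [c]
    ([krull_dim1_pi_regular]).  Then [c] is an inverse of [a] in [(A / bA)_a],
    and [x / a ^ m] is congruent to [x * c ^ m] ([frac_at_cover]).  The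
    regularity statement says that the multiplicative set of the
    [a ^ n * (1 - c * a)] meets [bA]; otherwise some prime containing [b] would
    avoid it, but a maximal ideal that omits [a] contains some [1 - c * a]. *)

Set Implicit Arguments.
Unset Strict Implicit.
Unset Printing Implicit Defensive.

Import GRing.Theory.
Local Open Scope ring_scope.

(** * Prime ideals avoiding a multiplicative set *)

Lemma prime_idealr_of_closed (R : comNzRingType) (P : {pred R}) :
  idealr_closed P -> prime_idealr_closed P ->
  exists Q : prime_idealr R, Q =i P.
Proof.
move=> idP primeP.
pose idQ := isIdealr.Build R P idP.
pose prQ := isPrimeIdealrClosed.Build R P primeP.
pose Q : prime_idealr R := HB.pack P idQ prQ.
by exists Q.
Qed.

Section PrimeAvoiding.
Local Open Scope classical_set_scope.

(** Krull's theorem: an ideal containing [I] that is maximal among those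
    disjoint from the multiplicative set [S] is prime.  Taking [S] to be [{1}]
    gives a maximal ideal containing [I]. *)
Lemma prime_avoiding (R : comNzRingType) (I S : set R) :
    I 0 -> (forall r x y, I x -> I y -> I (r * x + y)) ->
    S 1 -> (forall s t, S s -> S t -> S (s * t)) ->
    (forall x, I x -> ~ S x) ->
  exists P : prime_idealr R,
    (forall x, I x -> x \in P) /\ (forall s, S s -> s \notin P).
Proof.
move=> I0 Ilin S1 SM IS.
(* The empty set is admitted, since [Zorn_bigcup] also asks for the union of
   the empty chain. *)
pose adm (X : set R) := [/\ forall x, X x -> I `<=` X,
  forall r x y, X x -> X y -> X (r * x + y) & forall x, X x -> ~ S x].
have admU (F : set (set R)) : F `<=` adm -> total_on F subset ->
    adm (\bigcup_(X in F) X).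
  move=> Fadm Ftot; split=> [x [X FX Xx] y Iy
                            |r x y [X FX Xx] [Y FY Yy]|x [X FX Xx]].
  - by exists X => //; have [XI _ _] := Fadm _ FX; apply: (XI _ Xx).
  - have [XY|YX] := Ftot _ _ FX FY.
      by exists Y => //; have [_ Yl _] := Fadm _ FY; apply: Yl => //; apply: XY.
    by exists X => //; have [_ Xl _] := Fadm _ FX; apply: Xl => //; apply: YX.
  - by have [_ _ XS] := Fadm _ FX; apply: XS.
have [M [[MI Mlin MS] Mmax]] := Zorn_bigcup admU.
have [m Mm] : exists m, M m.
  apply: contrapT => M0; apply: (Mmax I); last by split=> // x _ y.
  split=> [x Mx|IM]; first by case: M0; exists x.
  by apply: M0; exists 0; apply: IM.
have {m Mm MI} IM := MI _ Mm.
have M0 := IM _ I0.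
(* By maximality, the ideal generated by [M] and [u] meets [S]. *)
have meets u : ~ M u -> exists m r, M m /\ S (r * u + m).
  move=> Mu; apply: contrapT => noS.
  apply: (Mmax [set x | exists m r, M m /\ x = r * u + m]).
    split=> [x Mx|]; first by exists x, 0; rewrite mul0r add0r.
    by move=> /(_ u) uM; apply/Mu/uM; exists 0, 1; rewrite mul1r addr0.
  split=> [_ _ y Iy|r _ _ [m [s [Mm ->]]] [n [t [Mn ->]]]|_ [m [r [Mm ->]]] Sx].
  - by exists y, 0; rewrite mul0r add0r; split=> //; apply: IM.
  - exists (r * m + n), (r * s + t); split; first exact: Mlin.
    by rewrite mulrDr mulrDl !mulrA addrACA.
  - by apply: noS; exists m, r.
have inM x : (x \in [pred x | `[< M x >]]) = `[< M x >] by [].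
have [||P PE] := @prime_idealr_of_closed R [pred x | `[< M x >]].
- split; first exact/asboolP.
    by apply/asboolP => M1; apply: MS M1 S1.
  by move=> r x y /asboolP Mx /asboolP My; apply/asboolP/Mlin.
- move=> u v /asboolP Muv; rewrite !inM; apply/orP; apply: contrapT => nuv.
  have [Mu|m [r [Mm Su]]] := meets u; first by apply: nuv; left; apply/asboolP.
  have [Mv|n [t [Mn Sv]]] := meets v; first by apply: nuv; right; apply/asboolP.
  apply: MS (SM _ _ Su Sv).
  have -> : (r * u + m) * (t * v + n) =
      (r * t) * (u * v) + ((r * u + m) * n + ((t * v) * m + 0)) by ring.
  exact: (Mlin _ _ _ Muv (Mlin _ _ _ Mn (Mlin _ _ _ Mm M0))).
exists P; split=> [x Ix|s Ss]; rewrite PE; first exact/asboolP/IM.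
by apply/asboolP => Ms; apply: MS Ss.
Qed.

End PrimeAvoiding.

(** * Domains of Krull dimension one *)

(** If [P + aA] were proper, a maximal ideal [M] above it would give a chain
    [0 < P < M] of length two. *)
Lemma krull_dim1_nonzero_prime_maximal (A : idomainType) (P : prime_idealr A)
    (a b : A) :
  has_krull_dim A 1 -> b != 0 -> b \in P -> a \notin P ->
  exists c, 1 - c * a \in P.
Proof.
move=> [_ dimA] b0 Pb Pa; apply: contrapT => noc.
have [||||x [c Pcx] x1|M [PM _]] :=
    @prime_avoiding A (fun x => exists c, x - c * a \in P) (fun s => s = 1).
- by exists 0; rewrite mul0r subr0 rpred0.
- move=> r x y [c Px] [d Py]; exists (r * c + d).
  by rewrite mulrDl opprD addrACA -mulrA -mulrBr rpredD ?idealMr.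
- by [].
- by move=> s t -> ->; rewrite mulr1.
- by apply: noc; exists c; rewrite -x1.
have [||Z ZE] := @prime_idealr_of_closed A (pred1 0).
- split; rewrite ?inE ?oner_eq0 //.
  by move=> r x y /eqP-> /eqP->; rewrite inE mulr0 addr0.
- by move=> u v; rewrite !inE mulf_eq0.
have PsubM : {subset P <= M}.
  by move=> x Px; apply: PM; exists 0; rewrite mul0r subr0.
have Ma : a \in M by apply: PM; exists 1; rewrite mul1r subrr rpred0.
have ZsubP x : x \in Z -> x \in P by rewrite ZE inE => /eqP->; apply: rpred0.
pose c (i : 'I_3) := if i == 0 :> nat then Z else if i == 1 :> nat then P else M.
suff /dimA : prime_chain c by [].
have bZ : b \notin Z by rewrite ZE inE.
move=> [[|[|[|//]]] i3] [[|[|[|//]]] j3] //= _; rewrite /c /=; split=> //.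
- by exists b.
- by move=> x /ZsubP/PsubM.
- by exists b => //; apply: PsubM.
- by exists a.
Qed.

(** [A / bA] is zero-dimensional, so the decreasing chain of ideals [(a ^ n)]
    becomes stationary in it.  The elements [a ^ n * (1 - c * a)] form a
    multiplicative set; a prime containing [b] and avoiding it would be maximal
    and omit [a], hence contain some [1 - c * a]. *)
Lemma krull_dim1_pi_regular (A : idomainType) (a b : A) :
  has_krull_dim A 1 -> b != 0 ->
  exists n c d, a ^+ n * (1 - c * a) = d * b.
Proof.
move=> dimA b0; apply: contrapT => no.
have [||||x [d ->] [n [c e]]|P [bP SP]] := @prime_avoiding A
    (fun x => exists d, x = d * b)
    (fun s => exists n c, s = a ^+ n * (1 - c * a)).
- by exists 0; rewrite mul0r.
- by move=> r _ _ [c ->] [d ->]; exists (r * c + d); rewrite mulrA -mulrDl.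
- by exists 0%N, 0; rewrite mul0r subr0 mulr1.
- move=> _ _ [m [c ->]] [n [d ->]]; exists (m + n)%N, (c + d - c * a * d).
  by rewrite exprD; ring.
- by apply: no; exists n, c, d; rewrite e.
have Pb : b \in P by apply: bP; exists 1; rewrite mul1r.
have Pa : a \notin P.
  by apply: SP; exists 1%N, 0; rewrite mul0r subr0 mulr1.
have [c] := krull_dim1_nonzero_prime_maximal dimA b0 Pb Pa.
by apply/negP/SP; exists 0%N, c; rewrite mul1r.
Qed.

(** * Multiplying a power series into a subring *)

Lemma course_of_values (T : Type) (h : seq T -> T) :
  exists g : nat -> T, forall n, g n = h (mkseq g n).
Proof.
pose pre n := iter n (fun s => rcons s (h s)) [::].
exists (fun n => h (pre n)) => n; congr (h _).
by elim: n => //= n IHn; rewrite mkseqS /= -IHn.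
Qed.

(** Coefficient [k + n] of [f * g] is the sum of [coefps f k * coefps g n] and
    of terms involving only earlier coefficients of [g], so a suitable [g] is
    found by recursion.  Its first coefficient is prescribed, which serves to
    make [f * g] nonzero. *)
Lemma mul_in_map_powser (R S : comNzRingType) (phi : {rmorphism R -> S})
    (f : {powser S}) k g0 r0 :
    (forall m, (m < k)%N -> coefps f m = 0) -> coefps f k * g0 = phi r0 ->
    (forall u, exists h r, u + coefps f k * h = phi r) ->
  exists g r, coefps g 0 = g0 /\ f * g = map_powser phi r.
Proof.
move=> f0 e0 surj.
have /choice[h hP] u : exists h, exists r, u + coefps f k * h = phi r.
  exact: surj.
(* If [s] lists the first [n] coefficients of [g], then [tail s] is their
   contribution to coefficient [k + n] of [f * g]. *)
pose tail (s : seq S) :=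
  \sum_(i < size s) coefps f (k + size s - i) * nth 0 s i.
have [g gE] := course_of_values (fun s => if s is [::] then g0 else h (tail s)).
have /choice[r rE] m : exists r, coefps (f * Powser g) m = phi r.
  have [mk|] := ltnP m k.
    exists 0; rewrite coefpsM rmorph0 big1 // => i _.
    by rewrite f0 ?mul0r // (leq_ltn_trans _ mk) // -ltnS.
  move=> /subnKC <-; move: (m - k)%N => n {m}.
  have -> : coefps (f * Powser g) (k + n) =
      tail (mkseq g n) + coefps f k * g n.
    rewrite mulrC coefpsM /tail size_mkseq -addnS addnC.
    (* The indices past [n] pair with coefficients of [f] below [k]. *)
    rewrite big_split_ord /= [X in _ + X]big1 => [|i _]; last first.
      by rewrite f0 ?mulr0 // addSn -addnS [(n + _)%N]addnC subnDr rev_ord_proof.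
    rewrite addr0 big_ord_recr /= addnK [g n * _]mulrC; congr (_ + _).
    by apply: eq_bigr => i _; rewrite nth_mkseq // mulrC.
  case: n => [|n]; rewrite gE /=.
    by exists r0; rewrite /tail /mkseq /= big_ord0 add0r.
  exact: hP.
exists (Powser g), (Powser r); split; first by rewrite /= gE.
by apply: powserP => m; rewrite rE.
Qed.

(** * The ring of fractions with denominator a power of [a] *)

Local Notation "x %:F" := (@FracField.tofrac _ x).

Lemma to_frac_at_inj (A : idomainType) (a : A) : injective (to_frac_at a).
Proof. by move=> x y /(congr1 val) /= /eqP; rewrite tofrac_eq => /eqP. Qed.

Lemma frac_at_clear_denom (A : idomainType) (a : A) (u : frac_at a) :
  a != 0 -> exists n b, u * to_frac_at a (a ^+ n) = to_frac_at a b.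
Proof.
move=> a0; case: u => u uP; have /asboolP[b [n uE]] := uP.
exists n, b; apply: val_inj; rewrite /= tofracXn uE divfK //.
by rewrite expf_neq0 // tofrac_eq0.
Qed.

(** Clearing the denominator of [v] turns it into some [b] in [A]; modulo [b]
    the inverse of [a] is represented by an element [c] of [A], so modulo [v]
    each fraction [x / a ^ n] is represented by [x * c ^ n]. *)
Lemma frac_at_cover (A : idomainType) (a : A) (v u : frac_at a) :
  has_krull_dim A 1 -> a != 0 -> v != 0 ->
  exists h r, u + v * h = to_frac_at a r.
Proof.
move=> dimA a0 v0; pose phi : {rmorphism A -> frac_at a} := to_frac_at a.
have [m [b vb]] := frac_at_clear_denom v a0.
have [n [x ux]] := frac_at_clear_denom u a0.
rewrite -[to_frac_at a]/(phi : _ -> _) in vb ux *.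
have aF : a%:F != 0 by rewrite tofrac_eq0.
have binv : a%:F^-1 \in frac_at_pred a.
  by apply/asboolP; exists 1, 1%N; rewrite tofrac1 expr1 div1r.
pose beta := FracAt binv.
have phiV i : phi (a ^+ i) * beta ^+ i = 1.
  rewrite rmorphXn -exprMn; apply/val_inj; rewrite rmorphXn /=.
  by rewrite divff // expr1n.
have b0 : b != 0.
  apply: contraTneq v0 => be; rewrite negbK -[v]mulr1 -(phiV m) mulrA vb be.
  by rewrite rmorph0 mul0r.
have [k [c [d cd]]] := krull_dim1_pi_regular a dimA b0.
have [w vw] : exists w, 1 - phi (c * a) = v * w.
  have cdphi : phi (a ^+ k) * (1 - phi (c * a)) = phi d * phi b.
    by rewrite -rmorphM -cd [RHS]rmorphM rmorphB rmorph1.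
  exists (phi d * phi (a ^+ m) * beta ^+ k).
  by rewrite -[LHS]mul1r -{1}(phiV k) mulrAC cdphi -vb; ring.
(* [u * (1 - (c * a) ^ n)] is a multiple of [1 - c * a], hence of [v]. *)
exists (- (w * u * \sum_(i < n) 1 ^+ (n.-1 - i) * phi (c * a) ^+ i)).
exists (x * c ^+ n).
rewrite mulrN !mulrA -vw mulrAC mulrC -subrXX expr1n mulrBr mulr1 subKr.
by rewrite [RHS]rmorphM -ux -mulrA -rmorphM mulrC -exprMn rmorphXn [a * c]mulrC mulrC.
Qed.

(** * Trivial generic fibre *)

Theorem proposition1 (A : idomainType) (dimA : has_krull_dim A 1)
    (a : A) (a_neq0 : a != 0) (a_nonunit : a \isn't a GRing.unit) :
  tgf_extension (map_powser (to_frac_at a)).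
Proof.
have phi_inj := @to_frac_at_inj A a.
split=> [f g /(congr1 (@coefps _)) fg|Q [f Qf f0]].
  by apply: powserP => n; apply: phi_inj; apply: (congr1 (@^~ n) fg).
have [k fk fk0] := powser_order f0.
have [n [b bE]] := frac_at_clear_denom (coefps f k) a_neq0.
have [|g [r [g0E fgE]]] := mul_in_map_powser fk0 bE.
  by move=> u; apply: frac_at_cover.
have an0 : to_frac_at a (a ^+ n) != 0.
  by rewrite -(rmorph0 (to_frac_at a)) (inj_eq phi_inj) expf_neq0.
exists r; first by have := idealMr g Qf; rewrite mulrC fgE.
(* [f * g = 0] would force [g = 0], but its first coefficient is [a ^ n]. *)
apply: contraTneq an0 => r0; rewrite -g0E negbK.
have /eqP := fgE; rewrite r0 rmorph0 mulf_eq0 (negPf f0) /= => /eqP->.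
by rewrite coefps0.
Qed.
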